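(* Let ${\cal M}\subset\mathbb{R}^{d+1}$, $d\ge 2$, be an $m$-dimensional, simply connected, compact Riemannian manifold, let $U\subset{\cal M}$ be open, and let $\varphi$ map $U$ homeomorphically onto an open set $V=\varphi(U)\subset\mathbb{R}^m$; write $v=v(u)=\varphi(u)=(v_1(u),\dots,v_m(u))$. Let ${\cal X}=\{z_1,\dots,z_n\}\subset U$ be a set of distinct points with associated finite sets of multi-indices $\Delta_1,\dots,\Delta_n\subset\mathbb{N}_0^m$, each containing $0$, and let $k=\max\{|\beta| : \beta\in\Delta_i \text{ for some } 1\le i\le n\}$. Let $f\in C^k(U)$ be real-valued, and let $g_1,\dots,g_n:U\to\mathbb{R}$ be cardinal basis functions with respect to ${\cal X}$ (see context). Then the interpolant $$H(u)=\sum_{i=1}^n T(u;f,z_i,\Delta_i)\,g_i(u),\qquad T(u;f,z_i,\Delta_i)=\sum_{\beta\in\Delta_i}\frac{D^\beta f(z_i)}{\beta_1!\cdots\beta_m!}\big(v(u)-v(z_i)\big)^\beta ,\qquad u\in U,$$ satisfies the Hermite-Birkhoff interpolation conditions $$D^\beta H(z_i)=D^\beta f(z_i)\qquad\text{for all }\beta\in\Delta_i,\ i=1,\dots,n.$$ Here $T(u;f,z_i,\Delta_i)$ is formally an incomplete Taylor expansion of $f$ at $z_i$, including only the partial derivatives whose orders belong to $\Delta_i$. The interpolant $H$ can also be expressed in the form $$H(u)=\sum_{i=1}^n\sum_{\beta\in\Delta_i}D^\beta f(z_i)\,g_{i\beta}(u),\qquad g_{i\beta}(u)=\frac{(v_1(u)-v_1(z_i))^{\beta_1}\cdots(v_m(u)-v_m(z_i))^{\beta_m}}{\beta_1!\cdots\beta_m!}\,g_i(u),$$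 with $\beta\in\Delta_i$, $1\le i\le n$.
   Context: For $\beta=(\beta_1,\dots,\beta_m)\in\mathbb{N}_0^m$, $|\beta|=\beta_1+\cdots+\beta_m$, and $x^\beta=x_1^{\beta_1}\cdots x_m^{\beta_m}$ for $x\in\mathbb{R}^m$. Derivatives of functions on $U$ are taken in the coordinates $v$: $D^\beta F(z)=\frac{\partial^{|\beta|}F(z)}{\partial v_1^{\beta_1}\cdots\partial v_m^{\beta_m}}$, i.e. the corresponding partial derivative of $F\circ\varphi^{-1}$ at $\varphi(z)$, and $F\in C^k(U)$ is understood in these coordinates. Functions $g_1,\dots,g_n:U\to\mathbb{R}$ are cardinal basis functions with respect to ${\cal X}$ if for all $j$: $g_j\in C^k(U)$; $g_j(u)\ge0$ and $\sum_{l=1}^n g_l(u)=1$ for all $u\in U$; $g_j(z_i)=\delta_{ji}$ (Kronecker delta) for all $i$; and $D^\beta g_j(z_i)=0$ for all $\beta\in\Delta_i$ with $|\beta|\ne0$, $i=1,\dots,n$.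
   Formalization: The interpolation conditions are proved assuming also that D^γ g_j(z_i)=0 for every nonzero γ≤β with β∈Δ_i (automatic if each Δ_i is downward closed); without this they can fail, e.g. Δ_1={0,(3,0)}, Δ_2={0,(1,0)}, g_2=sin²(πv_1/2), f=v_1. *)

(* Defs.v *)
From mathcomp Require Import all_boot all_order all_algebra finmap.
From mathcomp Require Import all_classical all_reals all_analysis.

Set Implicit Arguments.
Unset Strict Implicit.
Unset Printing Implicit Defensive.

Import Order.TTheory GRing.Theory Num.Theory.
Import numFieldNormedType.Exports.

Local Open Scope classical_set_scope.
Local Open Scope ring_scope.

(** ** Multi-indices *)

Definition multiindex (m : nat) := {ffun 'I_m -> nat}.

Definition midx0 (m : nat) : multiindex m := [ffun=> 0%N].

Definition midx_abs (m : nat) (b : multiindex m) : nat := (\sum_(l < m) b l)%N.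

Definition midx_fact (m : nat) (b : multiindex m) : nat :=
  (\prod_(l < m) (b l)`!)%N.

Definition midx_le (m : nat) (c b : multiindex m) : Prop :=
  forall l : 'I_m, (c l <= b l)%N.

Definition midx_pow (R : realType) (m : nat) (x : 'rV[R]_m)
    (b : multiindex m) : R :=
  \prod_(l < m) x ord0 l ^+ b l.

Definition max_order (m n : nat) (Delta : 'I_n -> {fset multiindex m}) : nat :=
  (\max_(i < n) \max_(b <- Delta i) midx_abs b)%N.

(** ** Partial derivatives and regularity on open subsets of R^m *)

Definition partial (R : realType) (m : nat) (l : 'I_m) (F : 'rV[R]_m -> R) :
    'rV[R]_m -> R :=
  fun x => 'D_(delta_mx ord0 l) F x.

(* The last coordinate is differentiated first. *)
Definition mpartial (R : realType) (m : nat) (b : multiindex m)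
    (F : 'rV[R]_m -> R) : 'rV[R]_m -> R :=
  foldr (fun l G => iter (b l) (partial l) G) F (enum 'I_m).

(* To be used with an open set V only. *)
Fixpoint Ck_on (R : realType) (m k : nat) (V : set 'rV[R]_m)
    (F : 'rV[R]_m -> R) : Prop :=
  (forall x, V x -> {for x, continuous F}) /\
  (if k is k'.+1 then
     forall l : 'I_m, (forall x, V x -> derivable F x (delta_mx ord0 l)) /\
                      Ck_on k' V (partial l F)
   else True).

Definition smooth_on (R : realType) (m : nat) (V : set 'rV[R]_m)
    (F : 'rV[R]_m -> R) : Prop :=
  forall k : nat, Ck_on k V F.

(** ** Topology of subsets *)

Definition homeomorphism_on (S T : topologicalType) (A : set S) (B : set T)
    (h : S -> T) (h' : T -> S) : Prop :=
  [/\ (forall x, A x -> B (h x) /\ h' (h x) = x),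
      (forall y, B y -> A (h' y) /\ h (h' y) = y),
      {within A, continuous h} & {within B, continuous h'}].

Definition open_in (T : topologicalType) (M U : set T) : Prop :=
  exists W : set T, open W /\ U = M `&` W.

Definition path_in (R : realType) (T : topologicalType) (M : set T) (x y : T)
    (p : R -> T) : Prop :=
  [/\ {within `[0, 1]%classic, continuous p},
      (forall t, 0 <= t <= 1 -> M (p t)),
      p 0 = x & p 1 = y].

Definition simply_connected (R : realType) (T : topologicalType) (M : set T) :
    Prop :=
  (forall x y, M x -> M y -> exists p : R -> T, path_in M x y p) /\
  (forall x (p : R -> T), M x -> path_in M x x p ->
     exists h : R * R -> T,
       {within `[0, 1]%classic `*` `[0, 1]%classic, continuous h} /\
       (forall s t : R, 0 <= s <= 1 -> 0 <= t <= 1 ->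
          [/\ M (h (s, t)), h (0, t) = p t, h (1, t) = x,
              h (s, 0) = x & h (s, 1) = x])).

(** ** Embedded Riemannian submanifolds of R^N (without boundary) *)

Definition local_parametrization (R : realType) (m N : nat) (M : set 'rV[R]_N)
    (Y : set 'rV[R]_m) (psi : 'rV[R]_m -> 'rV[R]_N) : Prop :=
  [/\ open Y,
      (forall j : 'I_N, smooth_on Y (fun y => psi y ord0 j)),
      (forall y, Y y -> row_free ('J psi y)) &
      exists (A : set 'rV[R]_N) (psi' : 'rV[R]_N -> 'rV[R]_m),
        open_in M A /\ homeomorphism_on Y A psi psi'].

Definition submanifold (R : realType) (m N : nat) (M : set 'rV[R]_N) : Prop :=
  forall p, M p ->
    exists (Y : set 'rV[R]_m) (psi : 'rV[R]_m -> 'rV[R]_N),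
      local_parametrization M Y psi /\ exists2 y, Y y & psi y = p.

(* [G p] is a bilinear form on R^N, of which only the restriction to the
   tangent space of M at p (the row space of 'J psi y, for psi y = p) matters.
   The induced metric is [G := fun=> 1%:M]. *)
Definition riemannian_metric (R : realType) (m N : nat) (M : set 'rV[R]_N)
    (G : 'rV[R]_N -> 'M[R]_N) : Prop :=
  forall (Y : set 'rV[R]_m) (psi : 'rV[R]_m -> 'rV[R]_N),
    local_parametrization M Y psi ->
    let gram y := 'J psi y *m G (psi y) *m ('J psi y)^T in
    [/\ (forall y, Y y -> (gram y)^T = gram y),
        (forall y (w : 'rV[R]_m), Y y -> w != 0 ->
           0 < (w *m gram y *m w^T) ord0 ord0) &
        (forall i j : 'I_m, smooth_on Y (fun y => gram y i j))].

Definition riemannian_submanifold (R : realType) (m N : nat)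
    (M : set 'rV[R]_N) (G : 'rV[R]_N -> 'M[R]_N) : Prop :=
  submanifold m M /\ riemannian_metric m M G.

(** ** Functions on a chart

   [phi] is the chart and [phi'] its inverse; functions on the chart domain
   are total functions of which only the values on that domain are used. *)

Definition Ck_chart (R : realType) (m N k : nat) (V : set 'rV[R]_m)
    (phi' : 'rV[R]_m -> 'rV[R]_N) (F : 'rV[R]_N -> R) : Prop :=
  Ck_on k V (F \o phi').

Definition Dchart (R : realType) (m N : nat) (phi : 'rV[R]_N -> 'rV[R]_m)
    (phi' : 'rV[R]_m -> 'rV[R]_N) (b : multiindex m) (F : 'rV[R]_N -> R)
    (p : 'rV[R]_N) : R :=
  mpartial b (F \o phi') (phi p).

Definition cardinal_basis (R : realType) (m n N : nat) (U : set 'rV[R]_N)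
    (V : set 'rV[R]_m) (phi : 'rV[R]_N -> 'rV[R]_m)
    (phi' : 'rV[R]_m -> 'rV[R]_N) (z : 'I_n -> 'rV[R]_N)
    (Delta : 'I_n -> {fset multiindex m}) (g : 'I_n -> 'rV[R]_N -> R) : Prop :=
  [/\ (forall j, Ck_chart (max_order Delta) V phi' (g j)),
      (forall j u, U u -> 0 <= g j u),
      (forall u, U u -> \sum_(l < n) g l u = 1),
      (forall j i, g j (z i) = (j == i)%:R) &
      (forall j i (b : multiindex m), b \in Delta i -> midx_abs b != 0%N ->
         Dchart phi phi' b (g j) (z i) = 0)].

(* The derivatives of the cardinal functions at z_i vanish for all nonzero
   orders lying below some element of Delta_i, not only for those in Delta_i.
   This follows from [cardinal_basis] when every Delta_i is downward closed
   ([flat_below_downclosed] below), but not in general, and the interpolation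
   conditions may then fail.  With v_1(z_1) = 0, v_1(z_2) = 1 and all other
   coordinates of v(z_1), v(z_2) equal to 0, take Delta_1 = {0, (3,0,..,0)},
   Delta_2 = {0, (1,0,..,0)}, g_1 = cos^2 (pi v_1 / 2),
   g_2 = sin^2 (pi v_1 / 2) and f = v_1: these g_j are cardinal basis
   functions, H = v_1 g_2, and the third derivative of H with respect to v_1
   at z_1 is 3 pi^2 / 2, whereas that of f is 0. *)
Definition flat_below (R : realType) (m n N : nat)
    (phi : 'rV[R]_N -> 'rV[R]_m) (phi' : 'rV[R]_m -> 'rV[R]_N)
    (z : 'I_n -> 'rV[R]_N) (Delta : 'I_n -> {fset multiindex m})
    (g : 'I_n -> 'rV[R]_N -> R) : Prop :=
  forall j i (b c : multiindex m),
    b \in Delta i -> midx_le c b -> midx_abs c != 0%N ->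
    Dchart phi phi' c (g j) (z i) = 0.

Lemma flat_below_downclosed (R : realType) (m n N : nat) (U : set 'rV[R]_N)
    (V : set 'rV[R]_m) (phi : 'rV[R]_N -> 'rV[R]_m)
    (phi' : 'rV[R]_m -> 'rV[R]_N) (z : 'I_n -> 'rV[R]_N)
    (Delta : 'I_n -> {fset multiindex m}) (g : 'I_n -> 'rV[R]_N -> R) :
  (forall i (b c : multiindex m),
     b \in Delta i -> midx_le c b -> c \in Delta i) ->
  cardinal_basis U V phi phi' z Delta g -> flat_below phi phi' z Delta g.
Proof. by move=> dc [_ _ _ _ gD] j i b c bD /(dc i b c bD); exact: gD. Qed.

(** ** The interpolant *)

Definition taylor (R : realType) (m N : nat) (phi : 'rV[R]_N -> 'rV[R]_m)
    (phi' : 'rV[R]_m -> 'rV[R]_N) (f : 'rV[R]_N -> R) (p : 'rV[R]_N)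
    (D : {fset multiindex m}) (u : 'rV[R]_N) : R :=
  \sum_(b <- D)
     Dchart phi phi' b f p / (midx_fact b)%:R * midx_pow (phi u - phi p) b.

Definition interpolant (R : realType) (m n N : nat)
    (phi : 'rV[R]_N -> 'rV[R]_m) (phi' : 'rV[R]_m -> 'rV[R]_N)
    (z : 'I_n -> 'rV[R]_N) (Delta : 'I_n -> {fset multiindex m})
    (g : 'I_n -> 'rV[R]_N -> R) (f : 'rV[R]_N -> R) (u : 'rV[R]_N) : R :=
  \sum_(i < n) taylor phi phi' f (z i) (Delta i) u * g i u.

Definition hermite_basis (R : realType) (m n N : nat)
    (phi : 'rV[R]_N -> 'rV[R]_m) (z : 'I_n -> 'rV[R]_N)
    (g : 'I_n -> 'rV[R]_N -> R) (i : 'I_n) (b : multiindex m)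
    (u : 'rV[R]_N) : R :=
  (\prod_(l < m) (phi u ord0 l - phi (z i) ord0 l) ^+ b l) / (midx_fact b)%:R
  * g i u.

(* Main.v *)
Require Import Defs.
From mathcomp Require Import all_boot all_order all_algebra finmap.
From mathcomp Require Import all_classical all_reals all_analysis.

Set Implicit Arguments.
Unset Strict Implicit.
Unset Printing Implicit Defensive.

Import Order.TTheory GRing.Theory Num.Theory.
Import numFieldNormedType.Exports.

Local Open Scope classical_set_scope.
Local Open Scope ring_scope.

(** The coordinate expression of [H] is [sum_j T_j g_j], where [T_j] is the
    incomplete Taylor polynomial at [v(z_j)].  Every term of the Leibniz
    expansion of [D^b (T_j g_j)] at [z_i] in which [g_j] is differentiated
    vanishes, since the order of that derivative is nonzero and below [b].
    Hence [D^b H (z_i) = sum_j D^b T_j (z_i) delta_ji = D^b T_i (z_i)], and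
    differentiating monomials [(v - v(z_i))^c / c!] at [z_i] gives
    [D^b T_i (z_i) = D^b f (z_i)]. *)

(** * Multi-indices as sequences of directions *)

(** The head of [s] is the outermost derivative, so an induction on [s] differentiates an already
    known formula once more. *)
Definition partials (R : realType) (m : nat) (s : seq 'I_m)
    (F : 'rV[R]_m -> R) : 'rV[R]_m -> R :=
  foldr (@partial R m) F s.

Definition midx_seq (m : nat) (b : multiindex m) : seq 'I_m :=
  flatten [seq nseq (b l) l | l <- enum 'I_m].

Section MultiindexSeq.
Variable m : nat.
Implicit Types (b : multiindex m) (l : 'I_m) (r s t : seq 'I_m).

Lemma mpartialE (R : realType) b (F : 'rV[R]_m -> R) :
  mpartial b F = partials (midx_seq b) F.
Proof.
rewrite /mpartial /partials /midx_seq; elim: (enum _) => //= l r ->.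
by rewrite foldr_cat; elim: (b l) => //= k ->.
Qed.

Lemma size_midx_seq b : size (midx_seq b) = midx_abs b.
Proof.
rewrite size_flatten /shape -map_comp sumnE big_map big_enum /=.
by apply: eq_bigr => l _; rewrite size_nseq.
Qed.

Lemma count_midx_seq b l : count_mem l (midx_seq b) = b l.
Proof.
rewrite count_flatten -map_comp sumnE big_map big_enum /= (bigD1 l) //= big1.
  by rewrite count_nseq /= eqxx mul1n addn0.
by move=> i /negPf il; rewrite count_nseq /= il.
Qed.

(** A subsequence is selected by a boolean mask, and cutting the mask at [size s1] cuts the
    subsequence. *)
Lemma subseq_cat_split (T : eqType) (s1 s2 t : seq T) : subseq t (s1 ++ s2) ->
  exists t1 t2 : seq T, [/\ t = t1 ++ t2, subseq t1 s1 & subseq t2 s2].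
Proof.
case/subseqP=> k; rewrite size_cat => sz ->.
have szt : size (take (size s1) k) = size s1 by rewrite size_takel // sz leq_addr.
exists (mask (take (size s1) k) s1), (mask (drop (size s1) k) s2).
by split; rewrite ?mask_subseq // -mask_cat // cat_take_drop.
Qed.

(** The big sequence consists of constant blocks, with distinct letters in the order of [r]. A
    subsequence keeps part of each block, so its letter counts determine it. The induction peels off
    the block of [a], a letter that [t2] cannot contain. *)
Lemma subseq_flatten_nseq (h : 'I_m -> nat) r t : uniq r ->
  subseq t (flatten [seq nseq (h l) l | l <- r]) ->
  t = flatten [seq nseq (count_mem l t) l | l <- r].
Proof.
elim: r t => [|a r IH] t /=; first by move=> _ /eqP ->.
case/andP=> ar ur /subseq_cat_split[t1 [t2 [-> t1s t2s]]].
have t1E : t1 = nseq (size t1) a.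
  apply/all_pred1P/allP => x /(mem_subseq t1s); rewrite mem_nseq.
  by case/andP.
have at2 : a \notin t2.
  apply/negP => /(mem_subseq t2s)/flattenP[_ /mapP[l lr ->]].
  by rewrite mem_nseq => /andP[_ /eqP al]; rewrite al lr in ar.
rewrite count_cat (count_memPn at2) addn0 {2}t1E count_nseq /= eqxx mul1n -t1E.
congr (_ ++ _); rewrite {1}(IH t2 ur t2s).
congr flatten; apply/eq_in_map => l lr; congr nseq.
rewrite count_cat t1E count_nseq /=; case: eqP => // al.
by rewrite al lr in ar.
Qed.

(** This links the Leibniz rule to [flat_below]: a nonempty list of directions that falls on one
    factor is again ordered as in [mpartial], hence comes from a nonzero multi-index below [b], the
    one that counts its letters. *)
Lemma subseq_midx_seq b t : subseq t (midx_seq b) -> t != [::] ->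
  exists c : multiindex m,
    [/\ midx_le c b, midx_abs c != 0%N & t = midx_seq c].
Proof.
move=> tb t0; pose c : multiindex m := [ffun l => count_mem l t].
have tE : t = midx_seq c.
  rewrite {1}(subseq_flatten_nseq (enum_uniq _) tb) /midx_seq; congr flatten.
  by apply: eq_map => l; rewrite ffunE.
exists c; split=> //; last by rewrite -size_midx_seq -tE size_eq0.
by move=> l; rewrite ffunE -(count_midx_seq b l) leq_count_subseq.
Qed.

Lemma midx_abs_le_max_order (n : nat) (Delta : 'I_n -> {fset multiindex m})
    (i : 'I_n) b : b \in Delta i -> (midx_abs b <= max_order Delta)%N.
Proof.
move=> bD; rewrite /max_order (bigD1 i) //= (big_fsetD1 b) //=.
by rewrite -maxnA leq_maxl.
Qed.

End MultiindexSeq.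

(** * Combinatorics of the Leibniz expansion *)

(* Pairs of complementary subsequences: the index set of the Leibniz rule. *)
Fixpoint splits (T : Type) (s : seq T) : seq (seq T * seq T) :=
  if s is x :: s' then
    [seq (x :: t.1, t.2) | t <- splits s'] ++
    [seq (t.1, x :: t.2) | t <- splits s']
  else [:: ([::], [::])].

Lemma mem_splits (T : eqType) (s : seq T) t : t \in splits s ->
  subseq t.1 s /\ subseq t.2 s.
Proof.
elim: s t => [|x s IH] t /=; first by rewrite inE => /eqP ->.
rewrite mem_cat => /orP[]/mapP[u /IH[u1 u2] ->] /=; rewrite eqxx; split => //.
  exact: subseq_trans u2 (subseq_cons _ _).
exact: subseq_trans u1 (subseq_cons _ _).
Qed.

(** Pairs that send the head [x] to the second component are killed by [B]. The other pairs form the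
    same sum over [s] with [A (x :: _)] in place of [A], which is why [A] is general in the
    induction. *)
Lemma sum_splits_flat (T : eqType) (R : pzRingType) (s : seq T)
    (A B : seq T -> R) :
  (forall t, subseq t s -> t != [::] -> B t = 0) ->
  \sum_(t <- splits s) A t.1 * B t.2 = A s * B [::].
Proof.
elim: s A => [|x s IH] A B0 /=; first by rewrite big_seq1.
rewrite big_cat !big_map /= (IH (fun t => A (x :: t))) /=; last first.
  by move=> t ts; apply: B0; apply: subseq_trans ts (subseq_cons _ _).
rewrite big_seq big1 ?addr0 // => t /mem_splits[_ t2].
by rewrite B0 ?mulr0 //= eqxx.
Qed.

(** * Calculus of [Ck_on] functions and the Leibniz rule *)

Section CkCalculus.
Variables (R : realType) (m : nat).
Implicit Types (V : set 'rV[R]_m) (F G : 'rV[R]_m -> R) (s : seq 'I_m).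

(** Functions are total but controlled only on [V]. Openness turns equality on [V] into equality
    near each point, the form in which limits and derivatives can be transferred. *)
Lemma near_open V (P : 'rV[R]_m -> Prop) x : open V -> V x ->
  (forall y, V y -> P y) -> \forall y \near x, P y.
Proof.
by move=> oV Vx VP; apply: filterS VP _; exact: open_nbhs_nbhs.
Qed.

Lemma eq_on_continuous V F G : open V -> (forall x, V x -> F x = G x) ->
  (forall x, V x -> {for x, continuous F}) ->
  forall x, V x -> {for x, continuous G}.
Proof.
move=> oV FG cF x Vx; suff : G y @[y --> x] --> G x by [].
rewrite -(FG x Vx); apply: cvg_trans (cF x Vx).
exact: (@near_eq_cvg _ _ (nbhs x) _ F G (near_open oV Vx FG)).
Qed.

Lemma eq_on_partial V F G l : open V -> (forall x, V x -> F x = G x) ->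
  forall x, V x -> partial l F x = partial l G x.
Proof. by move=> oV FG x Vx; apply: near_eq_derive; exact: near_open oV Vx FG. Qed.

Lemma eq_on_partials V F G s : open V -> (forall x, V x -> F x = G x) ->
  forall x, V x -> partials s F x = partials s G x.
Proof.
move=> oV FG; elim: s => [|l s IH] x Vx /=; first exact: FG.
exact: (eq_on_partial l oV IH).
Qed.

Lemma eq_on_Ck V k F G : open V -> (forall x, V x -> F x = G x) ->
  Ck_on k V F -> Ck_on k V G.
Proof.
move=> oV; elim: k F G => [|k IH] F G FG [cF dF]; split.
- exact: eq_on_continuous oV FG cF.
- by [].
- exact: eq_on_continuous oV FG cF.
- move=> l; have [dFl CF] := dF l; split; last first.
    exact: IH (eq_on_partial l oV FG) CF.
  by move=> x Vx; apply: near_eq_derivable (dFl x Vx); exact: near_open oV Vx FG.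
Qed.

Lemma CkS V k F : Ck_on k.+1 V F -> Ck_on k V F.
Proof.
elim: k F => [|k IH] F [cF dF]; split=> // l.
by have [dFl CF] := dF l; split=> //; exact: IH.
Qed.

Lemma Ck_le V j k F : (j <= k)%N -> Ck_on k V F -> Ck_on j V F.
Proof.
by move=> /subnK <-; elim: (k - j)%N => // i IH /CkS; exact: IH.
Qed.

(** [Ck_on] is unfolded from the innermost derivative, which is the last entry of [s]; hence the
    induction from the right. *)
Lemma Ck_partials V k s F : Ck_on (size s + k) V F -> Ck_on k V (partials s F).
Proof.
elim/last_ind: s F => // s l IH F.
rewrite size_rcons /partials foldr_rcons => -[_ /(_ l)[_ CF]].
exact: IH CF.
Qed.

Lemma Ck_partials_derivable V k s F l x : Ck_on k V F -> (size s < k)%N ->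
  V x -> derivable (partials s F) x (delta_mx ord0 l).
Proof.
move=> CF sk Vx.
have /Ck_partials[_ /(_ l)[dF _]] : Ck_on (size s + 1) V F.
  by apply: Ck_le CF; rewrite addn1.
exact: dF.
Qed.

Lemma partial_cst (c : R) l : partial l (fun=> c) = (fun=> 0) :> ('rV[R]_m -> R).
Proof. by apply/funext => x; rewrite /partial (derive_cst c x). Qed.

Lemma Ck_cst V k (c : R) : Ck_on k V (fun=> c).
Proof.
elim: k c => [|k IH] c; split=> //; try by move=> x _; exact: cst_continuous.
by move=> l; rewrite partial_cst; split=> // x _; exact: derivable_cst.
Qed.

Lemma Ck_add V k F G : open V -> Ck_on k V F -> Ck_on k V G ->
  Ck_on k V (fun x => F x + G x).
Proof.
move=> oV; elim: k F G => [|k IH] F G [cF dF] [cG dG]; split=> //.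
1,2: by move=> x Vx; exact: continuousD (cF x Vx) (cG x Vx).
move=> l; have [dFl CF] := dF l; have [dGl CG] := dG l; split.
  by move=> x Vx; exact: derivableD (dFl x Vx) (dGl x Vx).
apply: (eq_on_Ck oV _ (IH _ _ CF CG)) => x Vx.
by rewrite /partial -(deriveD (dFl x Vx) (dGl x Vx)).
Qed.

(** The derivative is [F * partial l G + G * partial l F]. The induction hypothesis applies to both
    products once the undifferentiated factors are lowered to order [k]. *)
Lemma Ck_mul V k F G : open V -> Ck_on k V F -> Ck_on k V G ->
  Ck_on k V (fun x => F x * G x).
Proof.
move=> oV; elim: k F G => [|k IH] F G [cF dF] [cG dG]; split=> //.
1,2: by move=> x Vx; exact: continuousM (cF x Vx) (cG x Vx).
have CFk : Ck_on k V F by exact: CkS.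
have CGk : Ck_on k V G by exact: CkS.
move=> l; have [dFl CF] := dF l; have [dGl CG] := dG l; split.
  by move=> x Vx; exact: derivableM (dFl x Vx) (dGl x Vx).
apply: (eq_on_Ck oV _ (Ck_add oV (IH _ _ CFk CG) (IH _ _ CGk CF))) => x Vx.
by rewrite /partial -[LHS](deriveM (dFl x Vx) (dGl x Vx)).
Qed.

Lemma Ck_sum V k (I : Type) (r : seq I) (F : I -> 'rV[R]_m -> R) : open V ->
  (forall i, Ck_on k V (F i)) -> Ck_on k V (fun x => \sum_(i <- r) F i x).
Proof.
move=> oV CF; elim: r => [|i r IH].
  apply: (eq_on_Ck oV _ (Ck_cst V k 0)) => x _; by rewrite big_nil.
by apply: (eq_on_Ck oV _ (Ck_add oV (CF i) IH)) => x _; rewrite big_cons.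
Qed.

Lemma partials_cst0 s : partials s (fun=> 0) = (fun=> 0) :> ('rV[R]_m -> R).
Proof. by elim: s => //= l s ->; rewrite partial_cst. Qed.

Lemma partialsD V k s F G : open V -> Ck_on k V F -> Ck_on k V G ->
  (size s <= k)%N ->
  forall x, V x ->
  partials s (fun y => F y + G y) x = partials s F x + partials s G x.
Proof.
move=> oV CF CG; elim: s => //= l s IH sk x Vx.
rewrite (eq_on_partial l oV (IH (ltnW sk)) Vx) /partial.
by rewrite -[RHS](deriveD (Ck_partials_derivable (l := l) CF sk Vx)
                          (Ck_partials_derivable (l := l) CG sk Vx)).
Qed.

Lemma partials_sum V k s (I : Type) (r : seq I) (F : I -> 'rV[R]_m -> R) :
  open V -> (forall i, Ck_on k V (F i)) -> (size s <= k)%N ->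
  forall x, V x ->
  partials s (fun y => \sum_(i <- r) F i y) x = \sum_(i <- r) partials s (F i) x.
Proof.
move=> oV CF sk x Vx; elim: r => [|i r IH].
  under [X in partials _ X]funext do rewrite big_nil.
  by rewrite big_nil partials_cst0.
under [X in partials _ X]funext do rewrite big_cons.
by rewrite big_cons (partialsD oV (CF i) (Ck_sum r oV CF) sk Vx) IH.
Qed.

(** The outermost derivative of each product in the expansion for [s] falls on either factor; the
    two cases are the two halves of [splits (l :: s)]. *)
Lemma partialsM V k s F G : open V -> Ck_on k V F -> Ck_on k V G ->
  (size s <= k)%N ->
  forall x, V x ->
  partials s (fun y => F y * G y) x =
  \sum_(t <- splits s) partials t.1 F x * partials t.2 G x.
Proof.
move=> oV CF CG; elim: s => [|l s IH] /= sk x Vx; first by rewrite big_seq1.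
rewrite (eq_on_partial l oV (IH (ltnW sk)) Vx) big_cat !big_map /= -big_split /=.
(* Derivability is recorded along with the product rule, since the derivative of the sum is split
   term by term below. *)
have dM t : t \in splits s ->
    derivable (partials t.1 F * partials t.2 G) x (delta_mx ord0 l) /\
    partial l (fun y => partials t.1 F y * partials t.2 G y) x =
      partials (l :: t.1) F x * partials t.2 G x +
      partials t.1 F x * partials (l :: t.2) G x.
  case/mem_splits => /size_subseq t1 /size_subseq t2.
  have d1 := Ck_partials_derivable (l := l) CF (leq_ltn_trans t1 sk) Vx.
  have d2 := Ck_partials_derivable (l := l) CG (leq_ltn_trans t2 sk) Vx.
  split; first exact: derivableM.
  by rewrite {1}/partial (deriveM d1 d2) addrC; congr (_ + _); exact: mulrC.
(* From here on [splits s] is an arbitrary list whose members satisfy [dM]. *)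
elim: (splits s) dM => [|t r IHr] dM.
  under [X in partial _ X]funext do rewrite big_nil.
  by rewrite big_nil partial_cst.
have [dt Et] := dM t (mem_head _ _).
have dMr u : u \in r -> _ := fun ur => dM u (mem_behead (s := t :: r) ur).
have dr : derivable (fun y => \sum_(u <- r) partials u.1 F y * partials u.2 G y)
   x (delta_mx ord0 l).
  elim: (r) dMr => [|u r' IHr'] dMr.
    under [X in derivable X]funext do rewrite big_nil.
    exact: derivable_cst.
  under [X in derivable X]funext do rewrite big_cons.
  apply: derivableD; first exact: (dMr u (mem_head _ _)).1.
  by apply: IHr' => v vr; apply: dMr; rewrite inE vr orbT.
under [X in partial _ X]funext do rewrite big_cons.
by rewrite big_cons {1}/partial (deriveD dt dr) -Et -IHr.
Qed.

(** To the orders contained in [s], the factor [G] behaves at [x] like the constant [G x]: only the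
    term with all derivatives on [F] survives. *)
Lemma partialsM_flat V k s F G x : open V -> Ck_on k V F -> Ck_on k V G ->
  (size s <= k)%N -> V x ->
  (forall t, subseq t s -> t != [::] -> partials t G x = 0) ->
  partials s (fun y => F y * G y) x = partials s F x * G x.
Proof.
move=> oV CF CG sk Vx G0; rewrite (partialsM oV CF CG sk Vx).
exact: (sum_splits_flat (fun t => partials t F x) G0).
Qed.

Lemma partials_cst (c : R) s : s != [::] ->
  partials s (fun=> c) = (fun=> 0) :> ('rV[R]_m -> R).
Proof.
elim: s => //= l [|l' s] IH _; first by rewrite partial_cst.
by rewrite IH // partial_cst.
Qed.

Lemma partialsMr_cst V k s F (c : R) x : open V -> Ck_on k V F ->
  (size s <= k)%N -> V x ->
  partials s (fun y => F y * c) x = partials s F x * c.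
Proof.
move=> oV CF sk Vx.
apply: (partialsM_flat oV CF (Ck_cst V k c) sk Vx) => t _ t0.
by rewrite partials_cst.
Qed.

End CkCalculus.

(** * Derivatives of shifted monomials *)

Section Monomials.
Variables (R : realType) (m : nat).
Implicit Types (V : set 'rV[R]_m) (F : 'rV[R]_m -> R) (x p : 'rV[R]_m).
Implicit Types (b c : multiindex m) (s : seq 'I_m) (l : 'I_m).

(** The difference quotient equals [d] for every [h != 0]. The case [d = 1] serves a coordinate in
    its own direction, [d = 0] a product of the other coordinates. *)
Lemma is_derive_affine_along F x (v : 'rV[R]_m) (d : R) :
  (forall h, F (h *: v + x) = F x + h * d) -> is_derive x v F d.
Proof.
move=> FE.
have cF : h^-1 *: ((F \o shift x) (h *: v) - F x) @[h --> 0^'] --> d.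
  apply: cvg_trans (cvg_cst d).
  apply: (@near_eq_cvg _ _ (0 : R)^' _ (cst d)).
  have : \forall h \near 0^', h != 0 :> R by exact: nbhs_dnbhs_neq.
  apply: filterS => h h0.
  by rewrite /= FE addrAC subrr add0r scalerA mulVf // scale1r.
  exact: dnbhs_filter.
split; first exact: cvgP cF.
exact: cvg_lim cF.
Qed.

Lemma is_derive_midx_pow p c l x :
  is_derive x (delta_mx ord0 l) (fun y => midx_pow (y - p) c)
    ((c l)%:R * midx_pow (x - p) [ffun i => (c i - (i == l))%N]).
Proof.
(* The monomial is [X ^+ c l * C], where [C] is constant in direction [l]. If [c l = 0], the
   truncated exponent stays 0 and the coefficient vanishes. *)
pose X (y : 'rV[R]_m) := y ord0 l - p ord0 l.
pose C (y : 'rV[R]_m) := \prod_(i < m | i != l) (y ord0 i - p ord0 i) ^+ c i.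
have dX : is_derive x (delta_mx ord0 l) X 1.
  by apply: is_derive_affine_along => h; rewrite /X !mxE !eqxx mulr1 -addrA addrC.
have dC : is_derive x (delta_mx ord0 l) C 0.
  apply: is_derive_affine_along => h; rewrite mulr0 addr0.
  by apply: eq_bigr => i /negPf il; rewrite !mxE eqxx il mulr0 add0r.
have -> : (fun y => midx_pow (y - p) c) = (X ^+ c l * C).
  apply/funext => y; rewrite /midx_pow (bigD1 l) //= fctE !mxE.
  by congr (_ * _); [rewrite exprfctE | apply: eq_bigr => i _; rewrite !mxE].
apply: is_derive_eq (is_deriveM (is_deriveX (c l) dX) dC) _.
rewrite scaler0 add0r /midx_pow (bigD1 l) //= ffunE eqxx subn1 !mxE.
rewrite /GRing.scale /= mulr1 mulrC -mulrA; congr (_ * (_ * _)).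
by apply: eq_bigr => i /negPf il; rewrite ffunE il subn0 !mxE.
Qed.

(** Repeated differentiation builds up falling factorials. They vanish once a direction [l] occurs
    more than [c l] times, so the truncated subtraction in the exponent does no harm. *)
Lemma partials_midx_pow p c s :
  partials s (fun y => midx_pow (y - p) c) =
  (fun x => (\prod_(l < m) (c l) ^_ (count_mem l s))%:R *
            midx_pow (x - p) [ffun l => (c l - count_mem l s)%N]).
Proof.
elim: s => [|l s /= ->]; apply/funext => x.
  rewrite /= big1 ?mul1r; last by move=> l _; rewrite ffactn0.
  by congr midx_pow; apply/ffunP => l; rewrite ffunE subn0.
set c' : multiindex m := [ffun _ => _].
have d' := is_derive_midx_pow p c' l x.
rewrite /partial (deriveZ _ (ex_derive (is_derive := d'))) (derive_val (is_derive := d')).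
rewrite /GRing.scale /= mulrA -natrM; congr (_%:R * _); last congr midx_pow.
  (* The exponent of coordinate [l] just before this derivative is the next factor of its falling
     factorial. *)
  rewrite (bigD1 l) //= [RHS](bigD1 l) //= eqxx add1n ffactnSr ffunE.
  rewrite mulnAC; congr (_ * _)%N; apply: eq_bigr => i.
  by rewrite eq_sym => /negPf ->; rewrite add0n.
by apply/ffunP => i; rewrite !ffunE eq_sym -subnDA addnC.
Qed.

(** For [b = c] the falling factorials are factorials and all exponents are 0. Otherwise some [l]
    has [b l < c l], which leaves a positive power of 0, or [c l < b l], which makes a falling
    factorial vanish. *)
Lemma partials_midx_pow_at p c b :
  partials (midx_seq b) (fun y => midx_pow (y - p) c) p =
  if b == c then (midx_fact b)%:R else 0.
Proof.
rewrite partials_midx_pow /midx_pow.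
under eq_bigr do rewrite count_midx_seq.
have [<-|bc] := eqVneq b c.
  rewrite [X in _ * X]big1 ?mulr1.
    by congr _%:R; apply: eq_bigr => i _; rewrite ffactnn.
  by move=> i _; rewrite ffunE count_midx_seq subnn.
have [l bcl] : exists l, b l != c l.
  apply/existsP; apply: contraNT bc; rewrite negb_exists => /forallP E.
  by apply/eqP/ffunP => l; apply/eqP; move: (E l); rewrite negbK.
move: bcl; rewrite neq_ltn => /orP[] bcl.
  rewrite [X in _ * X](bigD1 l) //= ffunE count_midx_seq !mxE subrr.
  by rewrite expr0n subn_eq0 leqNgt bcl mul0r mulr0.
by rewrite (bigD1 l) //= ffact_small // mul0n mul0r.
Qed.

Lemma continuous_midx_pow p c : continuous (fun y : 'rV[R]_m => midx_pow (y - p) c).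
Proof.
move=> x; apply: cvg_big; [exact: mul_continuous | exact: (nbhs_filter x) |].
move=> i _; apply: (@continuous_comp _ _ _
  (fun y : 'rV[R]_m => (y - p) ord0 i) (fun t : R => t ^+ c i)).
  apply: (@continuous_comp _ _ _ (fun y : 'rV[R]_m => y - p)
    (fun y : 'rV[R]_m => y ord0 i)); last exact: coord_continuous.
  by apply: continuousB => //; exact: cst_continuous.
exact: exprn_continuous.
Qed.

Lemma Ck_midx_pow V k p c : open V -> Ck_on k V (fun y => midx_pow (y - p) c).
Proof.
move=> oV; elim: k c => [|k IH] c; split=> //.
1,2: by move=> x _; exact: continuous_midx_pow.
move=> l; split=> [x _|]; first by have [] := is_derive_midx_pow p c l x.
apply: (eq_on_Ck oV _ (Ck_mul oV (Ck_cst V k (c l)%:R) (IH _))) => x _.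
by rewrite /partial (derive_val (is_derive := is_derive_midx_pow p c l x)).
Qed.

End Monomials.

(** * Incomplete Taylor polynomials in coordinates *)

Section TaylorSums.
Variables (R : realType) (m : nat).
Implicit Types (V : set 'rV[R]_m) (p : 'rV[R]_m) (D : {fset multiindex m}).

(** The coordinate form of [taylor], with arbitrary coefficients [a], so that it can be
    differentiated without reference to the chart. *)
Definition taylor_poly (a : multiindex m -> R) p D (x : 'rV[R]_m) : R :=
  \sum_(b <- D) a b / (midx_fact b)%:R * midx_pow (x - p) b.

Lemma Ck_taylor_poly V k a p D : open V -> Ck_on k V (taylor_poly a p D).
Proof.
move=> oV; apply: Ck_sum => // b.
by apply: Ck_mul => //; [exact: Ck_cst | exact: Ck_midx_pow].
Qed.

Lemma midx_fact_neq0 (b : multiindex m) : (midx_fact b)%:R != 0 :> R.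
Proof.
by rewrite pnatr_eq0 -lt0n prodn_gt0 // => l; exact: fact_gt0.
Qed.

(** At the centre [p] only the monomial of index [b] contributes. It occurs once in the finite set
    [D], and its derivative cancels the factorial. *)
Lemma partials_taylor_poly a p D (b : multiindex m) : b \in D ->
  partials (midx_seq b) (taylor_poly a p D) p = a b.
Proof.
move=> bD; set k := size (midx_seq b).
have oT : open [set: 'rV[R]_m] by exact: openT.
have CX c : Ck_on k setT (fun x => midx_pow (x - p) c) by exact: Ck_midx_pow.
rewrite (partials_sum D oT (k := k)) //; last first.
  by move=> c; apply: Ck_mul => //; exact: Ck_cst.
under eq_bigr => c _.
  under [X in partials _ X]funext do rewrite mulrC.
  rewrite (partialsMr_cst _ oT (CX c)) // partials_midx_pow_at.
  over.
rewrite (big_fsetD1 b) //= eqxx mulrCA divff ?midx_fact_neq0 // mulr1.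
rewrite big_seq big1 ?addr0 // => c; rewrite in_fsetD1 => /andP[/negPf cb _].
by rewrite eq_sym cb mul0r.
Qed.

End TaylorSums.

(** * Regularity, interpolation conditions and basis expansion of the interpolant *)

Theorem mainTheorem1 (R : realType) (d m n : nat) (hd : (2 <= d)%N)
  (M : set 'rV[R]_(d.+1)) (G : 'rV[R]_(d.+1) -> 'M[R]_(d.+1))
  (hM : riemannian_submanifold m M G)
  (hMcompact : compact M) (hMsc : simply_connected R M)
  (U : set 'rV[R]_(d.+1)) (hU : open_in M U)
  (V : set 'rV[R]_m) (hV : open V)
  (phi : 'rV[R]_(d.+1) -> 'rV[R]_m) (phi' : 'rV[R]_m -> 'rV[R]_(d.+1))
  (hphi : homeomorphism_on U V phi phi')
  (z : 'I_n -> 'rV[R]_(d.+1)) (hz : injective z) (hzU : forall i, U (z i))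
  (Delta : 'I_n -> {fset multiindex m}) (hDelta : forall i, midx0 m \in Delta i)
  (f : 'rV[R]_(d.+1) -> R) (hf : Ck_chart (max_order Delta) V phi' f)
  (g : 'I_n -> 'rV[R]_(d.+1) -> R)
  (hg : cardinal_basis U V phi phi' z Delta g) :
  let H := interpolant phi phi' z Delta g f in
  [/\ Ck_chart (max_order Delta) V phi' H,
      (flat_below phi phi' z Delta g ->
       forall i (b : multiindex m), b \in Delta i ->
         Dchart phi phi' b H (z i) = Dchart phi phi' b f (z i)) &
      forall u, U u ->
        H u = \sum_(i < n) \sum_(b <- Delta i)
                Dchart phi phi' b f (z i) * hermite_basis phi z g i b u].
Proof.
case: hphi => phiU phiV _ _; case: hg => gC _ _ gz _ /=.
set H := interpolant _ _ _ _ _ _; set k := max_order Delta.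
pose T i := taylor_poly (fun b => Dchart phi phi' b f (z i)) (phi (z i)) (Delta i).
(* [phi (phi' y) = y] holds only on [V], so the coordinate expression is an identity on [V]
   alone. *)
have HE y : V y -> (H \o phi') y = \sum_(i < n) T i y * (g i \o phi') y.
  by move=> /phiV[_ yE]; apply: eq_bigr => i _; rewrite /taylor /= yE.
have CTg i : Ck_on k V (fun y => T i y * (g i \o phi') y).
  by apply: Ck_mul => //; [exact: Ck_taylor_poly | exact: gC].
split.
- by apply: (eq_on_Ck hV _ (Ck_sum (index_enum 'I_n) hV CTg)) => y /HE ->.
- move=> flat i b bD; have [Vz zE] := phiU _ (hzU i).
  have bk : (size (midx_seq b) <= k)%N.
    by rewrite size_midx_seq; exact: midx_abs_le_max_order bD.
  rewrite {1}/Dchart mpartialE (eq_on_partials _ hV HE Vz).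
  rewrite (partials_sum _ hV CTg bk Vz).
  (* [g j] is flat at [z i] to all orders below [b], whichever [j] is, so it contributes only its
     value there, the Kronecker delta. *)
  have DTg j : partials (midx_seq b) (fun y => T j y * (g j \o phi') y) (phi (z i))
      = partials (midx_seq b) (T j) (phi (z i)) * (j == i)%:R.
    rewrite (partialsM_flat hV (Ck_taylor_poly _ _ _ _ hV) (gC j) bk Vz).
      by rewrite /= zE gz.
    move=> t /subseq_midx_seq /[apply] -[c [cb c0 ->]].
    by rewrite -mpartialE; exact: flat cb c0.
  rewrite (bigD1 i) //= DTg eqxx mulr1 big1 ?addr0.
    exact: partials_taylor_poly.
  by move=> j /negPf ji; rewrite DTg ji mulr0.
(* The second form holds term by term, by distributing [g i u] over the Taylor sum. *)
- move=> u _; apply: eq_bigr => i _; rewrite mulr_suml; apply: eq_bigr => b _.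
  rewrite /hermite_basis !mulrA; congr (_ * _).
  rewrite mulrAC; congr (_ * _ / _); rewrite /midx_pow.
  by apply: eq_bigr => l _; rewrite !mxE.
Qed.
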